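(* Let $S$ be a semigroup that is not inverse. Let $T_1$ and $T_2$ be inverse semigroups and let $\phi_i:S\to T_i$, $i=1,2$, be monomorphisms such that $S\phi_1$ is right ample in $T_1$ and $S\phi_2$ is left ample in $T_2$. Then the amalgam $(S;T_1,T_2;\phi_1,\phi_2)$ is not (strongly) embeddable in any semigroup.
   Context: Maps are written to the right of their arguments; a monomorphism is an injective semigroup homomorphism. For $x$ in an inverse semigroup, $x^{-1}$ denotes its unique inverse. A subsemigroup $U$ of an inverse semigroup $T$ is right ample in $T$ if $u^{-1}u\in U$ for all $u\in U$, and left ample in $T$ if $uu^{-1}\in U$ for all $u\in U$ (inverses taken in $T$). A semigroup amalgam $(S;T_1,T_2;\phi_1,\phi_2)$ consists of pairwise disjoint semigroups $S,T_1,T_2$ (disjointness can be arranged by passing to isomorphic copies) and monomorphisms $\phi_i:S\to T_i$, $i=1,2$. It is (strongly) embeddable if there exist a semigroup $T$ and monomorphisms $\psi_i:T_i\to T$, $i=1,2$, such that (i) $\phi_1\psi_1=\phi_2\psi_2$ (first $\phi_i$, then $\psi_i$), and (ii) for all $t_1\in T_1$, $t_2\in T_2$, if $t_1\psi_1=t_2\psi_2$ then there is $s\in S$ with $t_1=s\phi_1$ and $t_2=s\phi_2$. *)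

(* Defs.v *)
From mathcomp Require Import all_boot.
From mathcomp Require Import classical_sets.

Set Implicit Arguments.
Unset Strict Implicit.
Unset Printing Implicit Defensive.

Local Open Scope group_scope.
Local Open Scope classical_set_scope.

Definition inverse_of (T : semigroupType) (x y : T) : bool :=
  (x * y * x == x) && (y * x * y == y).

Definition inverse_semigroup (T : semigroupType) : Prop :=
  forall x : T, exists! y : T, inverse_of x y.

Lemma inverse_ex (T : semigroupType) (hT : inverse_semigroup T) (x : T) :
  exists y : T, inverse_of x y.
Proof. by have [y [xy _]] := hT x; exists y. Qed.

Definition inv (T : semigroupType) (hT : inverse_semigroup T) (x : T) : T :=
  xchoose (inverse_ex hT x).

Lemma inverse_of_inv (T : semigroupType) (hT : inverse_semigroup T) (x : T) :
  inverse_of x (inv hT x).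
Proof. exact: xchooseP. Qed.

Definition subsemigroup (T : semigroupType) (U : set T) : Prop :=
  forall u v : T, U u -> U v -> U (u * v).

Definition right_ample (T : semigroupType) (hT : inverse_semigroup T)
    (U : set T) : Prop :=
  subsemigroup U /\ forall u : T, U u -> U (inv hT u * u).

Definition left_ample (T : semigroupType) (hT : inverse_semigroup T)
    (U : set T) : Prop :=
  subsemigroup U /\ forall u : T, U u -> U (u * inv hT u).

(* Elements of S, T1 and T2 are never compared directly, and each clause is
   invariant under passing to isomorphic copies, so disjointness is not needed.
   Maps act on the left: "first phi1, then psi1" is psi1 \o phi1. *)
Definition strongly_embeddable (S T1 T2 : semigroupType)
    (phi1 : {multiplicative S -> T1}) (phi2 : {multiplicative S -> T2}) : Prop :=
  exists (T : semigroupType)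
         (psi1 : {multiplicative T1 -> T}) (psi2 : {multiplicative T2 -> T}),
    [/\ injective psi1,
        injective psi2,
        psi1 \o phi1 =1 psi2 \o phi2
      & forall (t1 : T1) (t2 : T2), psi1 t1 = psi2 t2 ->
          exists s : S, t1 = phi1 s /\ t2 = phi2 s].

(* Main.v *)
Require Import Defs.
From mathcomp Require Import all_boot.
From mathcomp Require Import classical_sets.

Local Open Scope classical_set_scope.

(** Suppose the amalgam embeds in a semigroup [T], and regard [S], [T1], [T2] as
    subsemigroups of [T]. An element [s] of [S] then has two inverses in [T]:
    [a], taken in [T1], and [b], taken in [T2]. The two ampleness hypotheses say
    that [a s] and [s b] lie in [S], hence in both [T1] and [T2]. So [s a] and
    [s b] are idempotents of [T1], both R-related to [s] in [T], and an inverse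
    semigroup has no two distinct R-related idempotents ([idempotent_R_inj]);
    hence [s a = s b]. Dually, [idempotent_L_inj] gives [a s = b s] inside [T2].
    Now [a = a s a = a s b = b s b = b] is an element of both [T1] and [T2], so
    it comes from [S] by strong embeddability, and [s] has an inverse in [S].
    Uniqueness of inverses is inherited from [T1], so [S] would be an inverse
    semigroup. *)

Local Open Scope group_scope.

Lemma inverse_ofP (T : semigroupType) (x y : T) :
  inverse_of x y <-> x * y * x = x /\ y * x * y = y.
Proof.
by split=> [/andP[/eqP-> /eqP->] | [xyx yxy]] //; rewrite /inverse_of xyx yxy !eqxx.
Qed.

Lemma inverse_of_inj {T : semigroupType} (hT : inverse_semigroup T) {x y z : T} :
  inverse_of x y -> inverse_of x z -> y = z.
Proof. by have [w [_ uniq_w]] := hT x => /uniq_w <- /uniq_w <-. Qed.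

(** The two equations force [e] and [g] to be R-related idempotents; then both
    [e] and [g] are inverses of [e]. *)
Lemma idempotent_R_inj {T : semigroupType} (hT : inverse_semigroup T) (e g : T) :
  e * g = g -> g * e = e -> e = g.
Proof.
move=> eg ge; have ee : e * e = e by rewrite -{2}ge mulgA eg ge.
have gg : g * g = g by rewrite -{2}eg mulgA ge eg.
by apply: (inverse_of_inj hT (x := e)); apply/inverse_ofP; rewrite ?eg ?ge ?ee ?eg ?gg.
Qed.

Lemma idempotent_L_inj {T : semigroupType} (hT : inverse_semigroup T) (e g : T) :
  e * g = e -> g * e = g -> e = g.
Proof.
move=> eg ge; have ee : e * e = e by rewrite -{1}eg -mulgA ge eg.
have gg : g * g = g by rewrite -{1}ge -mulgA eg ge.
by apply: (inverse_of_inj hT (x := e)); apply/inverse_ofP; rewrite ?eg ?ge ?ee ?eg ?gg.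
Qed.

Lemma inverse_of_morph {S T : semigroupType} (f : {multiplicative S -> T})
    (x y : S) :
  injective f -> inverse_of (f x) (f y) = inverse_of x y.
Proof. by move=> f_inj; rewrite /inverse_of -!gmulfM !(inj_eq f_inj). Qed.

(** Each element of [S] need only have some inverse: uniqueness passes down
    along the injection. *)
Lemma inverse_semigroup_sub {S T : semigroupType} (hT : inverse_semigroup T)
    (f : {multiplicative S -> T}) :
  injective f -> (forall s : S, exists s' : S, inverse_of s s') ->
  inverse_semigroup S.
Proof.
move=> f_inj inv_ex s; have [s' ss'] := inv_ex s.
exists s'; split=> // s'' ss''; apply: (f_inj).
by apply: (inverse_of_inj hT (x := f s)); rewrite inverse_of_morph.
Qed.

Theorem theorem3p4 (S T1 T2 : semigroupType)
    (hS : ~ inverse_semigroup S)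
    (hT1 : inverse_semigroup T1) (hT2 : inverse_semigroup T2)
    (phi1 : {multiplicative S -> T1}) (phi2 : {multiplicative S -> T2})
    (inj1 : injective phi1) (inj2 : injective phi2)
    (ample1 : right_ample hT1 (range phi1))
    (ample2 : left_ample hT2 (range phi2)) :
  ~ strongly_embeddable phi1 phi2.
Proof.
move=> [T [psi1 [psi2 [psi1_inj psi2_inj psi_phi meet]]]].
apply: hS; apply: (inverse_semigroup_sub hT1 phi1 inj1) => s.
have [e _ phi_e] := ample1.2 (phi1 s) (imageT phi1 s).
have [f _ phi_f] := ample2.2 (phi2 s) (imageT phi2 s).
have inv1 := inverse_of_inv hT1 (phi1 s).
have := inverse_of_inv hT2 (phi2 s).
move: (Defs.inv hT1 (phi1 s)) (Defs.inv hT2 (phi2 s)) => a b in inv1 phi_e phi_f *.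
move=> /inverse_ofP[sbs bsb]; have /inverse_ofP[sas asa] := inv1.
pose u := psi1 (phi1 s); pose A := psi1 a; pose B := psi2 b.
have uE : psi2 (phi2 s) = u by rewrite -[LHS]psi_phi.
have uAu : u * A * u = u by rewrite -!gmulfM sas.
have AuA : A * u * A = A by rewrite -!gmulfM asa.
have uBu : u * B * u = u by rewrite -uE -!gmulfM sbs.
have BuB : B * u * B = B by rewrite -uE -!gmulfM bsb.
have Au_e : psi2 (phi2 e) = A * u by rewrite -[LHS]psi_phi /= phi_e gmulfM.
have uB_f : psi1 (phi1 f) = u * B.
  by rewrite [LHS]psi_phi /= phi_f gmulfM uE.
have uA_uB : u * A = u * B.
  rewrite -uB_f -gmulfM; congr (psi1 _).
  apply: (idempotent_R_inj hT1); apply: psi1_inj; rewrite !gmulfM uB_f.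
    by rewrite mulgA uAu.
  by rewrite mulgA uBu.
have Au_Bu : A * u = B * u.
  rewrite -Au_e -uE -gmulfM; congr (psi2 _).
  apply: (idempotent_L_inj hT2); apply: psi2_inj; rewrite !gmulfM Au_e uE.
    by rewrite -mulgA [u * _]mulgA uBu.
  by rewrite -mulgA [u * _]mulgA uAu.
have AB : A = B by rewrite -AuA -mulgA uA_uB mulgA Au_Bu.
have [s' [a_s' _]] := meet a b AB.
by exists s'; rewrite -(inverse_of_morph phi1 _ _ inj1) -a_s'.
Qed.
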